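(* Let $\mathbf{CAs}=\{\mathbf{CAs}^{(\gamma)}:\gamma\ge1\}$, ordered by $\mathbf{CAs}^{(\gamma)}\preceq_{\mathrm{d}}\mathbf{CAs}^{(\gamma')}$ iff there exists an operad morphism $\mathbf{CAs}^{(\gamma')}\to\mathbf{CAs}^{(\gamma)}$. For positive integers $\gamma,\gamma'$ define $$\mathbf{CAs}^{(\gamma)}\wedge_{\mathrm{d}}\mathbf{CAs}^{(\gamma')}:=\mathbf{CAs}^{(\gcd(\gamma-1,\gamma'-1)+1)},\qquad \mathbf{CAs}^{(\gamma)}\vee_{\mathrm{d}}\mathbf{CAs}^{(\gamma')}:=\mathbf{CAs}^{(\mathrm{lcm}(\gamma-1,\gamma'-1)+1)}.$$ Then $(\mathbf{CAs},\preceq_{\mathrm{d}},\wedge_{\mathrm{d}},\vee_{\mathrm{d}})$ is a lattice (with $\wedge_{\mathrm{d}}$ the meet and $\vee_{\mathrm{d}}$ the join).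
   Context: A binary tree is either the leaf or an ordered pair of binary trees. $\mathbf{Mag}$ is the nonsymmetric set-theoretic operad of binary trees ($\mathbf{Mag}(n)$ = trees with $n$ leaves), with $\mathfrak{t}\circ_i\mathfrak{s}$ grafting the root of $\mathfrak{s}$ onto the $i$-th leaf of $\mathfrak{t}$. Combs: $\mathrm{LComb}_1=\mathrm{RComb}_1=(\text{leaf},\text{leaf})$, $\mathrm{LComb}_d=(\mathrm{LComb}_{d-1},\text{leaf})$, $\mathrm{RComb}_d=(\text{leaf},\mathrm{RComb}_{d-1})$. For $\gamma\ge1$, $\equiv_\gamma$ is the smallest operad congruence on $\mathbf{Mag}$ with $\mathrm{LComb}_\gamma\equiv_\gamma\mathrm{RComb}_\gamma$, and $\mathbf{CAs}^{(\gamma)}:=\mathbf{Mag}/_{\equiv_\gamma}$. Operad morphisms preserve arity, unit and partial compositions. $\gcd$ and $\mathrm{lcm}$ are taken on $\mathbb{N}$ with the conventions $\gcd(0,a)=a$ and $\mathrm{lcm}(0,a)=0$. *)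

(* Defs.v *)
From mathcomp Require Import all_boot boolp zify.

Set Implicit Arguments.
Unset Strict Implicit.
Unset Printing Implicit Defensive.

(* Equality of elements of a graded family whose degrees are only
   propositionally equal. *)
Definition graded_eq (T : nat -> Type) n m (x : T n) (y : T m) : Prop :=
  existT T n x = existT T m y.

(* Nonsymmetric set-theoretic operads. Inputs are numbered from 0: the partial
   composition usually written with index i in {1, ..., n} is [op_comp] at the
   ordinal of value i - 1. In the axioms, the ordinals k and l always exist when
   i and j do. *)
Record operad := Operad {
  op_car :> nat -> Type;
  op_unit : op_car 1;
  op_comp : forall n m, op_car n -> 'I_n -> op_car m -> op_car (n + m).-1;
  comp_unitl : forall n (x : op_car n), graded_eq (op_comp op_unit ord0 x) x;
  comp_unitr : forall n (x : op_car n) (i : 'I_n),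
    graded_eq (op_comp x i op_unit) x;
  comp_seq : forall n m p (x : op_car n) (y : op_car m) (z : op_car p)
    (i : 'I_n) (j : 'I_m) (k : 'I_(n + m).-1), k = i + j :> nat ->
    graded_eq (op_comp (op_comp x i y) k z) (op_comp x i (op_comp y j z));
  comp_par : forall n m p (x : op_car n) (y : op_car m) (z : op_car p)
    (i j : 'I_n) (k : 'I_(n + m).-1) (l : 'I_(n + p).-1),
    i < j -> k = (j + m).-1 :> nat -> l = i :> nat ->
    graded_eq (op_comp (op_comp x i y) k z) (op_comp (op_comp x j z) l y)
}.
Arguments op_unit {o}.
Arguments op_comp {o n m}.

Record operad_morphism (P Q : operad) := OperadMorphism {
  mor :> forall n, P n -> Q n;
  mor_unit : mor op_unit = op_unit;
  mor_comp : forall n m (x : P n) (i : 'I_n) (y : P m),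
    mor (op_comp x i y) = op_comp (mor x) i (mor y)
}.

Record is_congruence (O : operad) (E : forall n, O n -> O n -> Prop) : Prop := {
  cong_refl : forall n (x : O n), E n x x;
  cong_sym : forall n (x y : O n), E n x y -> E n y x;
  cong_trans : forall n (x y z : O n), E n x y -> E n y z -> E n x z;
  cong_comp : forall n m (x x' : O n) (i : 'I_n) (y y' : O m),
    E n x x' -> E m y y' -> E (n + m).-1 (op_comp x i y) (op_comp x' i y')
}.

Definition cong_gen (O : operad) (R : forall n, O n -> O n -> Prop)
    n (x y : O n) : Prop :=
  forall E : forall n, O n -> O n -> Prop, is_congruence E ->
    (forall m (u v : O m), R m u v -> E m u v) -> E n x y.

Lemma cong_genP (O : operad) (R : forall n, O n -> O n -> Prop) :
  is_congruence (@cong_gen O R).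
Proof.
split.
- by move=> n x E cE _; exact: (cong_refl cE).
- by move=> n x y xy E cE RE; apply: (cong_sym cE); exact: xy.
- move=> n x y z xy yz E cE RE.
  by apply: (cong_trans cE (xy E cE RE)); exact: yz.
- move=> n m x x' i y y' xx' yy' E cE RE.
  by apply: (cong_comp cE i); [exact: xx'|exact: yy'].
Qed.

Section Quotient.
Variables (O : operad) (E : forall n, O n -> O n -> Prop).
Hypothesis cE : is_congruence E.

(* The equivalence classes, as subsets. The quotient types {eq_quot e} are not
   usable here: they would put the type of operads in a universe too large for
   sets of operads to carry a [latticeType] structure. *)
Definition quot_car n : Type := {A : O n -> Prop | exists x, A = E x}.

Definition quot_class n (x : O n) : quot_car n :=
  exist _ (E x) (ex_intro _ x erefl).

Lemma quot_classP n (x y : O n) : quot_class x = quot_class y <-> E x y.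
Proof.
split=> [[e]|xy]; first by rewrite e; exact: (cong_refl cE).
apply: eq_exist; apply: funext => z; apply: propext; split=> h.
  exact: (cong_trans cE (cong_sym cE xy) h).
exact: (cong_trans cE xy h).
Qed.

Lemma quot_classE n (A : quot_car n) : exists x, A = quot_class x.
Proof. by case: A => A [x Ax]; exists x; apply: eq_exist. Qed.

Fact quot_comp_subproof n m (A : quot_car n) (i : 'I_n) (B : quot_car m) :
  exists z,
    (fun w => exists x y, [/\ sval A x, sval B y & E (op_comp x i y) w]) = E z.
Proof.
have [[x ->] [y ->]] := (quot_classE A, quot_classE B); exists (op_comp x i y).
apply: funext => w; apply: propext; split=> [[x' [y' [xx' yy' h]]]|h].
  exact: (cong_trans cE (cong_comp cE i xx' yy') h).
by exists x, y; split => //; exact: (cong_refl cE).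
Qed.

Definition quot_comp n m (A : quot_car n) (i : 'I_n) (B : quot_car m) :
    quot_car (n + m).-1 :=
  exist _ _ (quot_comp_subproof A i B).

Lemma quot_compE n m (x : O n) (i : 'I_n) (y : O m) :
  quot_comp (quot_class x) i (quot_class y) = quot_class (op_comp x i y).
Proof.
apply: eq_exist => /=; apply: funext => w; apply: propext.
split=> [[x' [y' [xx' yy' h]]]|h].
  exact: (cong_trans cE (cong_comp cE i xx' yy') h).
by exists x, y; split => //; exact: (cong_refl cE).
Qed.

Lemma quot_graded_eq n m (x : O n) (y : O m) : graded_eq x y ->
  @graded_eq quot_car _ _ (quot_class x) (quot_class y).
Proof.
by move/(congr1 (fun p => existT quot_car (projT1 p) (quot_class (projT2 p)))).
Qed.

Fact quot_unitl n (A : quot_car n) :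
  graded_eq (quot_comp (quot_class op_unit) ord0 A) A.
Proof.
have [x ->] := quot_classE A.
by rewrite quot_compE; exact/quot_graded_eq/comp_unitl.
Qed.

Fact quot_unitr n (A : quot_car n) (i : 'I_n) :
  graded_eq (quot_comp A i (quot_class op_unit)) A.
Proof.
have [x ->] := quot_classE A.
by rewrite quot_compE; exact/quot_graded_eq/comp_unitr.
Qed.

Fact quot_seq n m p (A : quot_car n) (B : quot_car m) (C : quot_car p)
    (i : 'I_n) (j : 'I_m) (k : 'I_(n + m).-1) : k = i + j :> nat ->
  graded_eq (quot_comp (quot_comp A i B) k C) (quot_comp A i (quot_comp B j C)).
Proof.
have [[[x ->] [y ->]] [z ->]] := (quot_classE A, quot_classE B, quot_classE C).
by move=> kij; rewrite !quot_compE; exact/quot_graded_eq/comp_seq.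
Qed.

Fact quot_par n m p (A : quot_car n) (B : quot_car m) (C : quot_car p)
    (i j : 'I_n) (k : 'I_(n + m).-1) (l : 'I_(n + p).-1) :
  i < j -> k = (j + m).-1 :> nat -> l = i :> nat ->
  graded_eq (quot_comp (quot_comp A i B) k C) (quot_comp (quot_comp A j C) l B).
Proof.
have [[[x ->] [y ->]] [z ->]] := (quot_classE A, quot_classE B, quot_classE C).
by move=> ij kj li; rewrite !quot_compE; exact/quot_graded_eq/comp_par.
Qed.

Definition quot_operad : operad :=
  Operad quot_unitl quot_unitr quot_seq quot_par.

End Quotient.

Inductive btree := Leaf | Node of btree & btree.

Fixpoint leaves t := if t is Node l r then leaves l + leaves r else 1.

Fixpoint graft t i s :=
  if t is Node l r then
    if i < leaves l then Node (graft l i s) r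
    else Node l (graft r (i - leaves l) s)
  else s.

Lemma leaves_gt0 t : 0 < leaves t.
Proof. by elim: t => //= l lP r rP; lia. Qed.

Lemma leaves_graft t i s : i < leaves t ->
  leaves (graft t i s) = (leaves t + leaves s).-1.
Proof.
elim: t i => [|l IHl r IHr] i //= lti.
have l0 := leaves_gt0 l; have r0 := leaves_gt0 r.
by case: ltnP => h /=; [rewrite IHl|rewrite IHr]; lia.
Qed.

Lemma graft_leaf t i : graft t i Leaf = t.
Proof.
by elim: t i => //= l IHl r IHr i; case: ifP => _; rewrite (IHl, IHr).
Qed.

Lemma graft_seq t s u i j : i < leaves t -> j < leaves s ->
  graft (graft t i s) (i + j) u = graft t i (graft s j u).
Proof.
elim: t i => [|l IHl r IHr] i /=; first by case: i.
move=> lti ltj; case: ltnP => h /=.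
  by rewrite leaves_graft // ifT ?IHl //; lia.
rewrite ifF; last by lia.
by congr Node; rewrite -IHr //; [congr graft|]; lia.
Qed.

Lemma graft_par t s u i j : i < j -> j < leaves t ->
  graft (graft t i s) (j + leaves s).-1 u = graft (graft t j u) i s.
Proof.
elim: t i j => [|l IHl r IHr] i j /=; first by lia.
move=> ltij ltj; have s0 := leaves_gt0 s; have u0 := leaves_gt0 u.
case: (ltnP i (leaves l)) => hi.
- case: (ltnP j (leaves l)) => hj /=.
    by rewrite !leaves_graft // !ifT ?IHl //; lia.
  rewrite leaves_graft // hi ifF; last by lia.
  by congr (Node _ (graft _ _ _)); lia.
- rewrite [j < leaves l]ltnNge ifF; last by lia.
  rewrite /= !ifF; [|lia..].
  by congr Node; rewrite -IHr; [congr graft| |]; lia.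
Qed.

Definition Mag_car n : Type := {t : btree | leaves t = n}.

Lemma Mag_graded_eq n m (x : Mag_car n) (y : Mag_car m) :
  sval x = sval y -> graded_eq x y.
Proof.
case: x y => [t tn] [s sm] /= ts; case: s / ts sm => sm.
by case: _ / tn; case: _ / sm.
Qed.

Fact Mag_comp_subproof n m (x : Mag_car n) (i : 'I_n) (y : Mag_car m) :
  leaves (graft (sval x) i (sval y)) = (n + m).-1.
Proof.
by case: x y => [t /= tn] [s /= sm]; rewrite leaves_graft tn ?sm.
Qed.

Definition Mag_comp n m (x : Mag_car n) (i : 'I_n) (y : Mag_car m) :
    Mag_car (n + m).-1 :=
  exist _ (graft (sval x) i (sval y)) (Mag_comp_subproof x i y).

Definition Mag_unit : Mag_car 1 := exist _ Leaf erefl.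

Fact Mag_unitl n (x : Mag_car n) : graded_eq (Mag_comp Mag_unit ord0 x) x.
Proof. exact: Mag_graded_eq. Qed.

Fact Mag_unitr n (x : Mag_car n) (i : 'I_n) :
  graded_eq (Mag_comp x i Mag_unit) x.
Proof. by apply: Mag_graded_eq; exact: graft_leaf. Qed.

Fact Mag_seq n m p (x : Mag_car n) (y : Mag_car m) (z : Mag_car p)
    (i : 'I_n) (j : 'I_m) (k : 'I_(n + m).-1) : k = i + j :> nat ->
  graded_eq (Mag_comp (Mag_comp x i y) k z) (Mag_comp x i (Mag_comp y j z)).
Proof.
move=> kij; apply: Mag_graded_eq => /=; rewrite kij graft_seq //.
  by rewrite (proj2_sig x).
by rewrite (proj2_sig y).
Qed.

Fact Mag_par n m p (x : Mag_car n) (y : Mag_car m) (z : Mag_car p)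
    (i j : 'I_n) (k : 'I_(n + m).-1) (l : 'I_(n + p).-1) :
  i < j -> k = (j + m).-1 :> nat -> l = i :> nat ->
  graded_eq (Mag_comp (Mag_comp x i y) k z) (Mag_comp (Mag_comp x j z) l y).
Proof.
move=> ij kj li; apply: Mag_graded_eq => /=.
by case: x y kj => [t /= tn] [s /= sm] ->; rewrite li -sm graft_par ?tn.
Qed.

Definition Mag : operad := Operad Mag_unitl Mag_unitr Mag_seq Mag_par.

(* Indexed by the number of internal nodes; starting from the leaf at d = 0
   gives lcomb 1 = rcomb 1 = Node Leaf Leaf. *)
Fixpoint lcomb d := if d is e.+1 then Node (lcomb e) Leaf else Leaf.
Fixpoint rcomb d := if d is e.+1 then Node Leaf (rcomb e) else Leaf.

Definition comb_rel (g : nat) n (x y : Mag n) : Prop :=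
  sval x = lcomb g /\ sval y = rcomb g.

Definition CAs_operad (g : nat) : operad :=
  quot_operad (cong_genP (@comb_rel g)).

Definition CAs : Type :=
  {O : operad | exists2 g, 0 < g & O = CAs_operad g}.

Definition CAs_of (g : nat) (g_gt0 : 0 < g) : CAs :=
  exist _ (CAs_operad g) (ex_intro2 _ _ g g_gt0 erefl).

Definition CAs_le (X Y : CAs) : Prop :=
  inhabited (operad_morphism (sval Y) (sval X)).

(* Main.v *)
(* A morphism from CAs^(g') to CAs^(g) sends the generator to the unique element
   of arity 2, hence the class of each tree to the class of the same tree. So it
   exists iff LComb_g' and RComb_g' are congruent modulo g, and this holds iff
   g - 1 divides g' - 1.  If it holds, the number of nodes on the left branch,
   which is an invariant modulo g - 1 of the congruence, gives g' = 1 modulo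
   g - 1.  Conversely, the numbers d with LComb_(d+1) and RComb_(d+1) congruent
   form a submonoid of the natural numbers, and g - 1 is one of them.  Hence
   CAs is isomorphic to the lattice of natural numbers ordered by divisibility. *)
Require Import Defs.
From mathcomp Require Import all_boot all_order.
From HB Require Import structures.
From mathcomp Require Import boolp zify.

Set Implicit Arguments.
Unset Strict Implicit.
Unset Printing Implicit Defensive.

Definition mag (t : btree) : Mag (leaves t) := exist _ t erefl.

Lemma Mag_eq n (x y : Mag n) : sval x = sval y -> x = y.
Proof. by case: x y => [t tn] [s sn] /= ts; exact: eq_exist. Qed.

(** * Morphisms between quotients of one operad *)

Section QuotientMap.
Variables (O : operad) (E F : forall n, O n -> O n -> Prop).
Hypotheses (cE : is_congruence E) (cF : is_congruence F).
Hypothesis EF : forall n (x y : O n), E x y -> F x y.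

(** Saturating an [E]-class under [F] gives an [F]-class, so the quotient map needs no choice of
    representatives. *)
Fact quot_map_subproof n (A : quot_operad cE n) :
  exists z, (fun w => exists2 x, sval A x & F x w) = F z.
Proof.
have [x ->] := quot_classE A; exists x.
apply: funext => w; apply: propext; split=> [[y xy yw]|xw].
  exact: (cong_trans cF (EF xy) yw).
by exists x => //; exact: (cong_refl cE).
Qed.

Definition quot_map n (A : quot_operad cE n) : quot_operad cF n :=
  exist _ _ (quot_map_subproof A).

Lemma quot_mapE n (x : O n) : quot_map (quot_class E x) = quot_class F x.
Proof.
apply: eq_exist => /=; apply: funext => w; apply: propext.
split=> [[y xy yw]|xw]; first exact: (cong_trans cF (EF xy) yw).
by exists x => //; exact: (cong_refl cE).
Qed.

Lemma quot_map_comp n m (A : quot_operad cE n) (i : 'I_n)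
    (B : quot_operad cE m) :
  quot_map (op_comp A i B) = op_comp (quot_map A) i (quot_map B).
Proof.
have [[x ->] [y ->]] := (quot_classE A, quot_classE B).
rewrite !quot_mapE.
transitivity (quot_map (quot_class E (op_comp x i y))).
  by congr quot_map; exact: quot_compE.
by rewrite quot_mapE; exact/esym/quot_compE.
Qed.

Definition quot_morphism : operad_morphism (quot_operad cE) (quot_operad cF) :=
  OperadMorphism (quot_mapE op_unit) quot_map_comp.

End QuotientMap.

(** This is what forces every morphism to send the generator to the generator. *)
Lemma mag2_eq (x y : Mag 2) : x = y.
Proof.
suff two_leaves (z : Mag 2) : sval z = Node Leaf Leaf.
  by apply: Mag_eq; rewrite !two_leaves.
case: z => -[|l r] //= lr2.
have leaf1 t : leaves t = 1 -> t = Leaf.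
  by case: t => //= u v; have := leaves_gt0 u; have := leaves_gt0 v; lia.
have l0 := leaves_gt0 l; have r0 := leaves_gt0 r.
have l1 : leaves l = 1 by lia.
have r1 : leaves r = 1 by lia.
by rewrite (leaf1 l l1) (leaf1 r r1).
Qed.

(** The induction step for generation by the arity 2 tree. The right input is filled first, so that
    the left one keeps index 0. *)
Lemma Node_comp l r n (x : Mag n) : sval x = Node l r ->
  graded_eq (op_comp (op_comp (mag (Node Leaf Leaf)) ord_max (mag r))
               ord0 (mag l)) x.
Proof. by move=> xlr; apply: Mag_graded_eq. Qed.

Section MagMorphism.
Variables (E F : forall n, Mag n -> Mag n -> Prop).
Hypotheses (cE : is_congruence E) (cF : is_congruence F).
Variable f : operad_morphism (quot_operad cE) (quot_operad cF).

Lemma mor_quot_mag n (x : Mag n) : mor f (quot_class E x) = quot_class F x.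
Proof.
move: n x.
suff mor_tree t : mor f (quot_class E (mag t)) = quot_class F (mag t).
  by move=> n [t tn]; case: _ / tn; exact: mor_tree.
elim: t => [|l IHl r IHr].
  have -> : mag Leaf = op_unit by exact: Mag_eq.
  exact: (mor_unit f).
pose N := mag (Node Leaf Leaf).
have fN : mor f (quot_class E N) = quot_class F N.
  by have [y ->] := quot_classE (mor f (quot_class E N)); rewrite (mag2_eq y N).
have fcomp n m (x : Mag n) (y : Mag m) i :
    mor f (quot_class E x) = quot_class F x ->
    mor f (quot_class E y) = quot_class F y ->
    mor f (quot_class E (op_comp x i y)) = quot_class F (op_comp x i y).
  move=> fx fy; have := mor_comp f (quot_class E x) i (quot_class E y).
  by rewrite fx fy /= (quot_compE cE) (quot_compE cF).
have := @Node_comp l r _ (mag (Node l r)) erefl.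
(* Stated on dependent pairs, so that rewriting with the graded equality changes the arity and the
   tree together. *)
pose P (p : {n & Mag n}) :=
  mor f (quot_class E (projT2 p)) = quot_class F (projT2 p).
rewrite -[_ = _]/(P (existT _ _ (mag (Node l r)))) /graded_eq => <-.
exact: fcomp (fcomp _ _ _ _ _ fN IHr) IHl.
Qed.

Lemma mor_quot_sub n (x y : Mag n) : E x y -> F x y.
Proof.
move=> /(quot_classP cE) xy; apply/(quot_classP cF).
by rewrite -!mor_quot_mag xy.
Qed.

End MagMorphism.

(** * The left branch invariant *)

Fixpoint left_rank t := if t is Node l _ then (left_rank l).+1 else 0.

(** The left branch ends at the leaf of index 0, so only a graft there lengthens it. *)
Lemma left_rank_graft t i s : i < leaves t ->
  left_rank (graft t i s) = left_rank t + (i == 0) * left_rank s.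
Proof.
elim: t i => [|l IHl r _] i /=.
  by case: i => // _; rewrite mul1n.
move=> _; have l0 := leaves_gt0 l; case: ltnP => [il|li] /=.
  by rewrite IHl // addSn.
by rewrite (gtn_eqF (leq_trans l0 li)) addn0.
Qed.

Lemma left_rank_lcomb d : left_rank (lcomb d) = d.
Proof. by elim: d => //= d ->. Qed.

Lemma leaves_lcomb d : leaves (lcomb d) = d.+1.
Proof. by elim: d => //= d ->; rewrite addn1. Qed.

Lemma leaves_rcomb d : leaves (rcomb d) = d.+1.
Proof. by elim: d => //= d ->. Qed.

Definition comb_cong g : forall n, Mag n -> Mag n -> Prop :=
  cong_gen (@comb_rel g).

Lemma comb_congW g n (x y : Mag n) :
  sval x = lcomb g -> sval y = rcomb g -> comb_cong g x y.
Proof. by move=> xl yr E _; apply. Qed.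

Lemma left_rank_congruence d :
  @is_congruence Mag
    (fun n x y => left_rank (sval x) = left_rank (sval y) %[mod d]).
Proof.
split=> // [n x y z -> //|n m x x' i y y' xx' yy'] /=.
rewrite !left_rank_graft ?(proj2_sig x) ?(proj2_sig x') //.
rewrite -modnDm xx' -[in LHS]modnMmr yy'.
by rewrite modnMmr modnDm.
Qed.

(** The two combs of the generating relation have left ranks [d.+1] and 1. *)
Lemma comb_cong_left_rank d n (x y : Mag n) : comb_cong d.+1 x y ->
  left_rank (sval x) = left_rank (sval y) %[mod d].
Proof.
move/(_ _ (left_rank_congruence d)); apply=> m u v [-> ->].
by rewrite left_rank_lcomb /= -addn1 modnDl.
Qed.

(** * The submonoid of related combs *)

Definition combs_related (E : forall n, Mag n -> Mag n -> Prop) d :=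
  forall n (x y : Mag n), sval x = lcomb d -> sval y = rcomb d -> E n x y.

Lemma lcombD a b : lcomb (a + b) = graft (lcomb a) 0 (lcomb b).
Proof. by elim: a => //= a ->; rewrite leaves_gt0. Qed.

Lemma rcombD a b : rcomb (a + b) = graft (rcomb a) a (rcomb b).
Proof. by elim: a => //= a ->; rewrite subn1. Qed.

Lemma graft_combs a b :
  graft (rcomb a.+1) 0 (lcomb b) = graft (lcomb b.+1) b.+1 (rcomb a).
Proof. by rewrite /= leaves_lcomb ltnn. Qed.

(** Compatibility with composition, read on the underlying trees: the transport from [(n + m).-1] to
    [k] is done once, here. *)
Lemma cong_graft E n m k (x x' : Mag n) (y y' : Mag m) (z z' : Mag k) i :
  is_congruence E -> i < n -> E n x x' -> E m y y' ->
  sval z = graft (sval x) i (sval y) ->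
  sval z' = graft (sval x') i (sval y') -> E k z z'.
Proof.
move=> cE ltin xx' yy' zE z'E.
have e : (n + m).-1 = k.
  by rewrite -(Mag_comp_subproof x (Ordinal ltin) y) -zE (proj2_sig z).
case: k / e in z z' zE z'E *.
have -> : z = op_comp x (Ordinal ltin) y by exact: Mag_eq.
have -> : z' = op_comp x' (Ordinal ltin) y' by exact: Mag_eq.
exact: (cong_comp cE).
Qed.

(* The intermediate tree, with left subtree LComb_b and right subtree RComb_a,
   is both a graft on RComb_(a+1) and a graft on LComb_(b+1). *)
Lemma combs_relatedD E a b : is_congruence E ->
  combs_related E a.+1 -> combs_related E b.+1 -> combs_related E (a + b).+1.
Proof.
move=> cE Ea Eb n x y xl yr.
pose L d : Mag d.+1 := exist _ (lcomb d) (leaves_lcomb d).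
pose R d : Mag d.+1 := exist _ (rcomb d) (leaves_rcomb d).
have wn : leaves (graft (rcomb a.+1) 0 (lcomb b)) = n.
  rewrite leaves_graft ?leaves_lcomb ?leaves_rcomb //.
  by rewrite -(proj2_sig x) xl leaves_lcomb; lia.
apply: (cong_trans cE (y := exist _ _ wn : Mag n)).
  apply: (cong_graft (i := 0) cE _ (Ea _ (L a.+1) (R a.+1) _ _)
           (cong_refl cE (L b))) => //=.
  by rewrite xl -addSn lcombD.
apply: (cong_graft (i := b.+1) cE _ (Eb _ (L b.+1) (R b.+1) _ _)
         (cong_refl cE (R a))) => //.
  exact: graft_combs.
by rewrite yr addnC -addSn rcombD.
Qed.

Lemma comb_cong_combs d e : d %| e -> combs_related (@comb_cong d.+1) e.+1.
Proof.
case/dvdnP=> k ->; elim: k => [|k IHk].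
  (* For [k = 0], [lcomb 1] and [rcomb 1] are the same tree. *)
  move=> n x y xl yr; rewrite (@Mag_eq _ x y) ?xl //.
  exact: (cong_refl (cong_genP _)).
rewrite mulSn; apply: combs_relatedD (cong_genP _) _ IHk => n x y.
exact: comb_congW.
Qed.

Lemma CAs_morphismP d e :
  inhabited (operad_morphism (CAs_operad e.+1) (CAs_operad d.+1)) <-> d %| e.
Proof.
split=> [[f]|de].
  have rl : leaves (rcomb e.+1) = leaves (lcomb e.+1).
    by rewrite leaves_lcomb leaves_rcomb.
  have ef : @comb_cong e.+1 _ (mag (lcomb e.+1)) (exist _ (rcomb e.+1) rl).
    exact: comb_congW.
  have /comb_cong_left_rank := mor_quot_sub f ef.
  rewrite /= left_rank_lcomb => /eqP.
  (* [rcomb e.+1] has left rank 1, which cancels in [e + 1 = 0 + 1] modulo [d]. *)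
  by rewrite -addn1 -[X in _ == X %[mod _]]add0n eqn_modDr mod0n.
apply/inhabits/quot_morphism => n x y.
(* By minimality of the finer congruence, only its generating pair has to be checked. *)
move/(_ _ (cong_genP _)); apply=> m u v [ul vr].
exact: (comb_cong_combs de ul vr).
Qed.

(** * Transport of the divisibility lattice *)

Definition CAs_index (X : CAs) : nat := (s2val (cid2 (svalP X))).-1.

Definition CAs_at (n : nat) : CAs := CAs_of (ltn0Sn n).

Lemma CAs_indexK : cancel CAs_index CAs_at.
Proof.
rewrite /CAs_index => X; case: cid2 => g g0 /= XE.
by case: X XE => O OP /= OE; apply: eq_exist; rewrite prednK // OE.
Qed.

Lemma CAs_le_at d e : CAs_le (CAs_at d) (CAs_at e) <-> d %| e.
Proof. exact: CAs_morphismP. Qed.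

(** The index is a chosen one, but the order determines it up to mutual divisibility, hence
    uniquely. *)
Lemma CAs_atK : cancel CAs_at CAs_index.
Proof.
have CAs_le_refl X : CAs_le X X by split; exists (fun n => id).
move=> n; apply/eqP; rewrite eqn_dvd; apply/andP.
by split; apply/CAs_le_at; rewrite CAs_indexK.
Qed.

Lemma CAs_leE X Y : CAs_le X Y <-> CAs_index X %| CAs_index Y.
Proof. by rewrite -CAs_le_at !CAs_indexK. Qed.

Lemma CAs_ofE g (g0 : 0 < g) : CAs_of g0 = CAs_at g.-1.
Proof. by apply: eq_exist; rewrite prednK. Qed.

Section CAsLattice.
Variable d : Order.disp_t.

HB.instance Definition _ := Choice.copy CAs (can_type CAs_indexK).
(** [natdvd] is the set of naturals ordered by divisibility, with meet [gcdn] and join [lcmn]. *)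
HB.instance Definition _ : Order.POrder d CAs := Order.POrder.copy CAs
  (can_type (CAs_indexK : @cancel natdvd _ CAs_index CAs_at)).
HB.instance Definition _ := @Order.IsoLattice.Build d CAs _ natdvd
  CAs_index CAs_at CAs_indexK CAs_atK (fun _ _ => erefl).

Definition CAs_lattice : latticeType d := CAs.

End CAsLattice.

Theorem theorem3p2p8 (d : Order.disp_t) :
  exists c : Order.Lattice.axioms_ d CAs,
  let L : Order.Lattice.type d := Order.Lattice.Pack c in
  [/\ forall X Y : L, (X <= Y)%O <-> CAs_le X Y,
      forall (g g' : nat) (hg : 0 < g) (hg' : 0 < g'),
        ((CAs_of hg : L) `&` (CAs_of hg' : L))%O
        = CAs_of (ltn0Sn (gcdn g.-1 g'.-1))
    & forall (g g' : nat) (hg : 0 < g) (hg' : 0 < g'),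
        ((CAs_of hg : L) `|` (CAs_of hg' : L))%O
        = CAs_of (ltn0Sn (lcmn g.-1 g'.-1))].
Proof.
exists (Order.Lattice.class (CAs_lattice d)) => L.
split=> [X Y|g g' hg hg'|g g' hg hg'].
- by rewrite CAs_leE.
- by rewrite !CAs_ofE; congr (CAs_at (gcdn _ _)); exact: CAs_atK.
- by rewrite !CAs_ofE; congr (CAs_at (lcmn _ _)); exact: CAs_atK.
Qed.
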